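(* Let $d\ge 1$, $s\in\mathbb{N}$, and let $\mathbf{u}\in\mathbb{C}^d$ have i.i.d. entries $u_j\sim\mathcal{CN}(0,1)$. For all $\mathbf{x},\mathbf{y}\in\mathbb{R}^d$, $$k_{2s}(\mathbf{x},\mathbf{y}):=\mathbb{E}\big[\,|\mathbf{x}^\top\mathbf{u}|^{2s}\,|\mathbf{y}^\top\mathbf{u}|^{2s}\,\big]=\sum_{i=0}^{s}(s!)^2\binom{s}{i}^2\,(\mathbf{x}^\top\mathbf{y})^{2i}\,\big(\|\mathbf{x}\|_2\|\mathbf{y}\|_2\big)^{2(s-i)} .$$ Equivalently, for nonzero $\mathbf{x},\mathbf{y}$ with $\cos\theta=\frac{\mathbf{x}^\top\mathbf{y}}{\|\mathbf{x}\|_2\|\mathbf{y}\|_2}$, $k_{2s}(\mathbf{x},\mathbf{y})=\|\mathbf{x}\|_2^{2s}\|\mathbf{y}\|_2^{2s}\sum_{i=0}^s(s!)^2\binom{s}{i}^2\cos^{2i}\theta$. Consequently, with $\mathbf{U}\in\mathbb{C}^{D\times d}$ having i.i.d. $\mathcal{CN}(0,1)$ entries and $\phi(\mathbf{x})=\frac{1}{\sqrt D}|\mathbf{U}\mathbf{x}|^{2s}$ (entrywise), $\phi(\mathbf{x})^\top\phi(\mathbf{y})\to k_{2s}(\mathbf{x},\mathbf{y})$ almost surely as $D\to\infty$.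
   Context: $\mathcal{CN}(0,1)$ denotes the standard circularly-symmetric complex Gaussian distribution: $u=a+ib$ with $a,b$ independent real $\mathcal{N}(0,1/2)$, so $\mathbb{E}|u|^2=1$. For $\mathbf{x}\in\mathbb{R}^d$ and $\mathbf{u}\in\mathbb{C}^d$, $\mathbf{x}^\top\mathbf{u}=\sum_j x_j u_j$ (no conjugation). $\|\cdot\|_2$ is the Euclidean norm. The rows of $\mathbf{U}$ are i.i.d. copies of $\mathbf{u}$, and $|\cdot|^{2s}$ applied to a vector acts entrywise. *)

(* Defs.v *)
From HB Require Import structures.
From mathcomp Require Import all_boot all_order all_algebra.
From mathcomp Require Import all_classical all_reals all_analysis.
Set Implicit Arguments. Unset Strict Implicit. Unset Printing Implicit Defensive.
Import Order.TTheory GRing.Theory Num.Theory.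
Import numFieldNormedType.Exports.
Local Open Scope classical_set_scope.
Local Open Scope ring_scope.

Section defs.
Context {R : realType}.

Definition dotr (d : nat) (x y : 'rV[R]_d) : R := \sum_(j < d) x 0 j * y 0 j.
Definition norm2 (d : nat) (x : 'rV[R]_d) : R := Num.sqrt (dotr x x).

Definition iid_normal {dT} {T : measurableType dT} (P : probability T R)
    {I : eqType} (X : I -> T -> R) (m sigma : R) : Prop :=
  (forall i, measurable_fun [set: T] (X i)) /\
  forall (J : seq I) (A : I -> set R), uniq J -> (forall i, measurable (A i)) ->
    P (\bigcap_(i in [set i | i \in J]) (X i @^-1` A i)) =
    (\prod_(i <- J) normal_prob m sigma (A i))%E.

Definition reim_family {T} {I : Type} (a b : I -> T -> R) : I + I -> T -> R :=
  fun k => match k with inl i => a i | inr i => b i end.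

(* u_i = a i + sqrt(-1) * b i are i.i.d. CN(0,1): all real and imaginary parts
   are mutually independent N(0, 1/2) (standard deviation sqrt(1/2)). *)
Definition iid_CN {dT} {T : measurableType dT} (P : probability T R)
    {I : eqType} (a b : I -> T -> R) : Prop :=
  iid_normal P (reim_family a b) 0 (Num.sqrt (2^-1)).

(* |x^T u|^2 where u = a + i b (componentwise, at outcome w):
   x^T u = (sum_j x_j a_j) + i (sum_j x_j b_j), x real. *)
Definition abs2_xTu {T} (d : nat) (x : 'rV[R]_d) (a b : 'I_d -> T -> R) (w : T) : R :=
  (\sum_(j < d) x 0 j * a j w) ^+ 2 + (\sum_(j < d) x 0 j * b j w) ^+ 2.

Definition k2s_formula (d s : nat) (x y : 'rV[R]_d) : R :=
  \sum_(i < s.+1) ((s`! ^ 2 * 'C(s, i) ^ 2)%:R * dotr x y ^+ (2 * i)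
     * (norm2 x * norm2 y) ^+ (2 * (s - i))).

(* phi(x)^T phi(y) = (1/D) sum_{r<D} |x^T U_r|^{2s} |y^T U_r|^{2s},
   where row r of U has entries Ua (r, j) + i Ub (r, j). *)
Definition feature_inner {T} (d s D : nat) (x y : 'rV[R]_d)
    (Ua Ub : nat * 'I_d -> T -> R) (w : T) : R :=
  D%:R^-1 * \sum_(r < D)
     (abs2_xTu x (fun j => Ua (val r, j)) (fun j => Ub (val r, j)) w ^+ s *
      abs2_xTu y (fun j => Ua (val r, j)) (fun j => Ub (val r, j)) w ^+ s).

End defs.

(* Main.v *)
(* Proof idea.  For independent centred Gaussians g_i of variance sigma^2, Stein's identity
   E[(sum_i v_i g_i) F(g)] = sigma^2 E[D_v F(g)] holds for every polynomial F, where D_v is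
   the derivative in the direction v.  Put |x^T u|^2 = W_x and V = Re(x^T u * conj (y^T u)).
   Applied to the real and imaginary parts of x^T u and y^T u, with sigma^2 = 1/2, it gives
   for f(p, q) = E[W_x^p W_y^q] and h(p, q) = E[V W_x^p W_y^q] the recursions
     f(p+1, q) = (p+1) |x|^2 f(p, q) + q (x.y) h(p, q-1),
     h(p, q)   = (p+1) (x.y) f(p, q) + q |y|^2 h(p, q-1),
   whose solution at p = q = s is the stated sum.  The same formula with exponents s * k
   gives all moments of the summands of phi(x)^T phi(y); their centred sums S_D thus satisfy
   E[S_D^4] = O(D^2), so that sum_D (S_D / D)^4 is almost surely finite. *)
Require Import Defs.
From HB Require Import structures.
From mathcomp Require Import all_boot all_order all_algebra.
From mathcomp Require Import all_classical all_reals all_analysis.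
From mathcomp Require Import measurable_realfun ring lra.
Set Implicit Arguments. Unset Strict Implicit. Unset Printing Implicit Defensive.
Import Order.TTheory GRing.Theory Num.Theory.
Import numFieldNormedType.Exports.
Local Open Scope classical_set_scope.
Local Open Scope ring_scope.

(** * Integration against a density *)

Section density.
Context {R : realType} {d1 d2 : measure_display}.
Context {T : measurableType d1} {S : measurableType d2}.
Variables (mu : {measure set T -> \bar R}) (nu : {measure set S -> \bar R}).
Variables (X : T -> S) (G : T -> R).
Hypotheses (mX : measurable_fun [set: T] X) (mG : measurable_fun [set: T] G).
Hypothesis G0 : forall x, 0 <= G x.
Hypothesis nuE : forall A : set S, measurable A ->
  nu A = (\int[mu]_x (\1_A (X x) * G x)%:E)%E.

Import HBNNSimple.

(** [nu] is the image under [X] of the measure with density [G], known on sets only. Simple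
    functions follow by linearity over their level sets, the rest by monotone convergence. With [X]
    the identity this serves the normal density; with [X] one variable of a family it serves
    independence. *)
Lemma ge0_integral_density (f : S -> \bar R) :
    measurable_fun [set: S] f -> (forall y, 0 <= f y)%E ->
  (\int[nu]_y f y = \int[mu]_x (f (X x) * (G x)%:E))%E.
Proof.
move=> mf f0.
pose f_ := nnsfun_approx measurableT mf.
have mfX n : measurable_fun [set: T] (fun x => f_ n (X x)).
  by apply: measurableT_comp => //; exact: measurable_funP.
transitivity (limn (fun n => \int[nu]_y (f_ n y)%:E)%E).
  rewrite -monotone_convergence//.
  - apply: eq_integral => y _; apply/esym/cvg_lim => //.
    exact: cvg_nnsfun_approx.
  - by move=> n; exact/measurable_EFinP/measurable_funP.
  - by move=> n y _; rewrite lee_fin.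
  - by move=> y _ m n mn; rewrite lee_fin; exact/lefP/nd_nnsfun_approx.
rewrite [X in limn X](_ : _ =
    (fun n => (\int[mu]_x ((f_ n (X x))%:E * (G x)%:E))%E)); last first.
  apply/funext => n.
  have mk k : measurable (f_ n @^-1` [set k]).
    by rewrite -[_ @^-1` _]setTI; exact: measurable_funP.
  have mkX k : measurable_fun [set: T] (\1_(f_ n @^-1` [set k]) \o X : T -> R).
    by apply: measurableT_comp.
  transitivity (\sum_(k \in range (f_ n))
      \int[mu]_x (k * (\1_(f_ n @^-1` [set k]) (X x) * G x))%:E)%E.
    under eq_integral do rewrite fimfunE -fsumEFin//.
    rewrite ge0_integral_fsum//; last 2 first.
    - by move=> y; exact/measurable_EFinP/measurable_funM.
    - by move=> y x _; rewrite nnfun_muleindic_ge0.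
    apply: eq_fsbigr => k; rewrite inE => -[y _ <-].
    under [RHS]eq_integral do rewrite EFinM.
    rewrite integralZl_indic_nnsfun// integral_indic//= setIT.
    rewrite ge0_integralZl//; last 3 first.
    - by apply/measurable_EFinP; apply: measurable_funM => //; exact: mkX.
    - by move=> x _; rewrite lee_fin mulr_ge0.
    - by rewrite lee_fin.
    by rewrite nuE.
  rewrite -ge0_integral_fsum//; last 2 first.
  - move=> k; apply/measurable_EFinP; apply: measurable_funM => //.
    by apply: measurable_funM => //; exact: mkX.
  - by move=> k x _; rewrite mulrA EFinM mule_ge0 ?nnfun_muleindic_ge0 ?lee_fin.
  apply: eq_integral => x _; rewrite fsumEFin// -EFinM; congr EFin.
  rewrite [in RHS]fimfunE -[RHS]mulrC mulr_fsumr//=.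
  by apply: eq_fsbigr => k _; ring.
rewrite -monotone_convergence//; last 3 first.
- by move=> n; apply/measurable_EFinP/measurable_funM.
- by move=> n x _; rewrite lee_fin mulr_ge0.
- move=> x _ m n mn; rewrite lee_fin ler_wpM2r//; exact/lefP/nd_nnsfun_approx.
apply: eq_integral => x _; apply/cvg_lim => //.
by apply: cvgeZr => //; exact: cvg_nnsfun_approx.
Qed.

End density.

(** * Moments of the normal distribution *)

Section normal_moments.
Context {R : realType} (s : R).
Hypothesis s0 : s != 0.
Local Notation mu := (@lebesgue_measure R).
Local Notation pdf := (normal_pdf 0 s).
Local Notation N := (normal_prob 0 s).

Lemma ge0_integral_normal (f : R -> R) : measurable_fun setT f ->
  (forall x, 0 <= f x) ->
  (\int[N]_x (f x)%:E = \int[mu]_x (f x * pdf x)%:E)%E.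
Proof.
move=> mf f0.
rewrite (@ge0_integral_density _ _ _ _ _ mu N id pdf)//.
- exact: measurable_normal_pdf.
- by move=> x; exact: normal_pdf_ge0.
- move=> A mA; rewrite /normal_prob/= [LHS]integral_mkcond; apply: eq_integral => x _.
  by rewrite patchE indicE; case: ifPn; rewrite ?mul1r ?mul0r.
- exact/measurable_EFinP.
Qed.

Lemma integrable_normal (f : R -> R) : measurable_fun setT f ->
  mu.-integrable setT (fun x => (f x * pdf x)%:E) ->
  N.-integrable setT (EFin \o f).
Proof.
move=> mf /integrableP[_ fi]; apply/integrableP; split; first exact/measurable_EFinP.
under eq_integral do rewrite /= .
rewrite ge0_integral_normal//; last exact: measurableT_comp.
apply: le_lt_trans fi; apply: ge0_le_integral => //.
- by move=> x _; rewrite lee_fin mulr_ge0// normal_pdf_ge0.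
- apply/measurable_EFinP/measurable_funM; first exact: measurableT_comp.
  exact: measurable_normal_pdf.
- do 2 apply: measurableT_comp => //; apply: measurable_funM => //.
  exact: measurable_normal_pdf.
- by move=> x _; rewrite lee_fin normrM (ger0_norm (normal_pdf_ge0 _ _ _)).
Qed.

(** Both [|f|] and [f + |f|] are nonnegative, so the previous case applies to them, and the integral
    of [|f|] cancels. *)
Lemma Rintegral_normal (f : R -> R) : measurable_fun setT f ->
  mu.-integrable setT (fun x => (f x * pdf x)%:E) ->
  \int[N]_x f x = \int[mu]_x (f x * pdf x).
Proof.
move=> mf fi; have Nf := integrable_normal mf fi.
have mnf : measurable_fun setT (fun x => `|f x|) by exact: measurableT_comp.
have nfi : mu.-integrable setT (fun x => (`|f x| * pdf x)%:E).
  apply: eq_integrable (integrable_abse fi) => // x _ /=.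
  by rewrite normrM (ger0_norm (normal_pdf_ge0 _ _ _)).
have Nnf := integrable_normal mnf nfi.
have nE : \int[N]_x `|f x| = \int[mu]_x (`|f x| * pdf x).
  by rewrite /Rintegral ge0_integral_normal.
have : \int[N]_x (f x + `|f x|) = \int[mu]_x ((f x + `|f x|) * pdf x).
  rewrite /Rintegral ge0_integral_normal//; first exact: measurable_funD.
  by move=> x; have := ler_norm (- f x); rewrite normrN; lra.
rewrite RintegralD// nE; under [RHS]eq_Rintegral do rewrite mulrDl.
by rewrite RintegralD//; exact: addIr.
Qed.

Lemma norm_expr_le_expR (a : R) n : 0 < a ->
  exists2 C : R, 0 < C & forall x, `|x| ^+ n <= C * expR (a * x ^+ 2).
Proof.
(* The summand 1 covers [|x| <= 1]. For larger [|x|], the bound [t <= expR t] at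
   [t = a * x ^+ 2 / n], raised to the power [n], controls [x ^+ (2 * n)], which dominates
   [|x| ^+ n]. *)
move=> a0; exists (1 + (n%:R / a) ^+ n).
  by rewrite ltr_pwDl// exprn_ge0// divr_ge0// ltW.
move=> x; have ax0 : 0 <= a * x ^+ 2 by rewrite mulr_ge0 ?sqr_ge0 ?ltW.
have e1 : 1 <= expR (a * x ^+ 2) by rewrite -expR0 ler_expR.
have x2n : (x ^+ 2) ^+ n <= (n%:R / a) ^+ n * expR (a * x ^+ 2).
  case: n => [|n]; first by rewrite !expr0 mul1r.
  have n0 : n.+1%:R != 0 :> R by rewrite pnatr_eq0.
  rewrite [in leRHS](_ : a * x ^+ 2 = (a * x ^+ 2 / n.+1%:R) * n.+1%:R); last first.
    by rewrite divfK.
  rewrite expRM_natr -exprMn ler_pXn2r ?nnegrE ?sqr_ge0//; last first.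
    by rewrite mulr_ge0 ?expR_ge0// divr_ge0// ltW.
  rewrite mulrC -ler_pdivrMr ?divr_gt0// invf_div.
  apply: le_trans (expR_ge1Dx _); rewrite -[leLHS]add0r lerD//.
  by rewrite mulrCA mulrA.
rewrite mulrDl mul1r; have [x1|x1] := leP `|x| 1.
  apply: ler_wpDr; first by rewrite mulr_ge0 ?expR_ge0 ?exprn_ge0 ?divr_ge0// ltW.
  by apply: le_trans e1; rewrite exprn_ile1.
apply: ler_wpDl; first exact: expR_ge0.
apply: le_trans x2n; rewrite -[x ^+ 2]real_normK ?num_real// expr2 exprMn.
by rewrite ler_peMr ?exprn_ge0// exprn_ege1// ltW.
Qed.

(** Doubling the variance absorbs any power of [x]: this yields both integrability of the moments
    and decay at infinity. *)
Lemma expr_mul_normal_pdf_le n :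
  exists2 C : R, 0 < C & forall x, `|x| ^+ n * pdf x <= C * normal_pdf 0 (Num.sqrt 2 * s) x.
Proof.
(* The gap between the exponents of the two densities: [1 / (2 s^2) - 1 / (4 s^2)]. *)
have a0 : 0 < (s ^+ 2 *+ 4)^-1 by rewrite invr_gt0 pmulrn_lgt0 ?exprn_even_gt0.
have t0 : Num.sqrt 2 * s != 0 :> R by rewrite mulf_neq0 // gt_eqF ?sqrtr_gt0.
have [C C0 Cx] := norm_expr_le_expR n a0.
have p0 := normal_peak_gt0 s0; have pt0 := normal_peak_gt0 t0.
exists (C * normal_peak s / normal_peak (Num.sqrt 2 * s)).
  by rewrite divr_gt0 ?mulr_gt0.
move=> x; rewrite !normal_pdfE// [leRHS]mulrA divfK ?gt_eqF// mulrCA [C * _]mulrC -mulrA.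
rewrite ler_pM2l// /normal_fun !subr0.
apply: le_trans (ler_wpM2r (expR_ge0 _) (Cx x)) _.
rewrite -mulrA ler_pM2l// -expRD ler_expR exprMn sqr_sqrtr//.
by rewrite le_eqVlt; apply/orP; left; apply/eqP; field.
Qed.

Lemma integrable_expr_normal_pdf n :
  mu.-integrable setT (fun x => (x ^+ n * pdf x)%:E).
Proof.
have [C C0 Cx] := expr_mul_normal_pdf_le n.
have := integrableZl measurableT C (integrable_normal_pdf 0 (Num.sqrt 2 * s)).
apply: le_integrable => //.
  apply/measurable_EFinP/measurable_funM; first exact: measurable_funX.
  exact: measurable_normal_pdf.
move=> x _ /=; rewrite lee_fin normrM normrX (ger0_norm (normal_pdf_ge0 _ _ _)).
by apply: le_trans (Cx x) _; rewrite ler_norm.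
Qed.

Lemma cvg_expr_normal_pdf n (e : R) : `|e| = 1 ->
  (fun k : nat => (e * k%:R) ^+ n * pdf (e * k%:R)) @ \oo --> 0.
Proof.
(* One extra power of [|x|] in the bound leaves a factor [1 / |x|], here a harmonic term. *)
move=> e1; have [C C0 Cx] := expr_mul_normal_pdf_le n.+1.
have t0 : Num.sqrt 2 * s != 0 :> R by rewrite mulf_neq0 // gt_eqF ?sqrtr_gt0.
pose B := C * normal_peak (Num.sqrt 2 * s).
rewrite -(cvg_shiftS (fun k : nat => (e * k%:R) ^+ n * pdf (e * k%:R))) /=.
apply/cvgr0Pnorm_le; rewrite -/(_ --> _) //=.
have /cvgrPdist_le h : (fun k => B * harmonic k) @ \oo --> B * 0.
  by apply: cvgMr; exact: cvg_harmonic.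
move=> eps eps0; near=> k.
have : `|B * 0 - B * harmonic k| <= eps by near: k; exact: h.
rewrite mulr0 sub0r normrN; apply: le_trans.
rewrite normrM normrX (ger0_norm (normal_pdf_ge0 _ _ _)) /=.
have k0 : 0 < k.+1%:R :> R by [].
have xk : `|e * k.+1%:R| = k.+1%:R by rewrite normrM e1 mul1r ger0_norm// ltW.
have pt0 := normal_peak_gt0 t0.
rewrite [leRHS]ger0_norm; last by rewrite ltW// divr_gt0// mulr_gt0.
rewrite ler_pdivlMr// mulrC.
have := Cx (e * k.+1%:R); rewrite exprS xk -mulrA => /le_trans; apply.
by rewrite ler_pM2l// normal_pdf_ub.
Unshelve. all: by end_near. Qed.

Definition normal_moment n := \int[N]_x x ^+ n.

Lemma normal_moment0 : normal_moment 0 = 1.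
Proof.
rewrite /normal_moment; under eq_Rintegral do rewrite expr0.
by rewrite Rintegral_cst//= (probability_setT (normal_prob 0 s)) mulr1.
Qed.

Lemma normal_momentE n : normal_moment n = \int[mu]_x (x ^+ n * pdf x).
Proof.
by rewrite /normal_moment Rintegral_normal//; exact: integrable_expr_normal_pdf.
Qed.

Lemma integrable_expr_normal n : N.-integrable setT (EFin \o (fun x => x ^+ n)).
Proof. by apply: integrable_normal => //; exact: integrable_expr_normal_pdf. Qed.

(** The derivative of the density is [- x / s ^+ 2] times the density. At [n = 0] the truncated
    exponent [n.-1] is multiplied by 0. *)
Lemma is_derive_expr_normal_pdf n (x : R) : is_derive x 1 (fun x => x ^+ n * pdf x)
  (n%:R * (x ^+ n.-1 * pdf x) - (s ^+ 2)^-1 * (x ^+ n.+1 * pdf x)).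
Proof.
have -> : pdf = (fun x => normal_peak s * expR (- (x ^+ 2 / (s ^+ 2 *+ 2)))).
  by apply/funext => y; rewrite normal_pdfE// /normal_fun subr0 mulNr.
have dX k : is_derive x 1 (fun y : R => y ^+ k) (k%:R * x ^+ k.-1).
  have -> : (fun y : R => y ^+ k) = id ^+ k by apply/funext => y; rewrite exprfctE.
  by apply: is_derive_eq; rewrite /GRing.scale/= mulr1.
pose b : R := (s ^+ 2 *+ 2)^-1.
have dq : is_derive x 1 (fun y : R => - (y ^+ 2 * b)) (- (2 * x * b)).
  apply: (is_derive_eq (is_deriveN (is_deriveM (dX 2) (is_derive_cst b x 1)))).
  by rewrite /GRing.scale/= mulr0 add0r expr1 [b * _]mulrC.
have de : is_derive x 1 (fun y : R => expR (- (y ^+ 2 * b)))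
    (expR (- (x ^+ 2 * b)) * - (2 * x * b)).
  exact: (is_derive1_comp (is_derive_expR _) dq).
have dc := is_derive_cst (normal_peak s) x 1.
apply: (is_derive_eq (is_deriveM (dX n) (is_deriveM dc de))).
rewrite /GRing.scale/= !fctE -/b.
have -> : (s ^+ 2)^-1 = 2 * b.
  by rewrite /b; field.
rewrite [x ^+ n.+1]exprS; ring.
Qed.
End normal_moments.

(** Dominated convergence with bound [|f|]: each point lies in all large enough intervals. This
    carries the fundamental theorem of calculus from compact intervals to the line. *)
Lemma cvg_integral_symitv {R : realType} (f : R -> R) :
  (@lebesgue_measure R).-integrable setT (EFin \o f) ->
  (\int[@lebesgue_measure R]_(x in `[(- n%:R)%R, n%:R%R]) (f x)%:E)%E @[n --> \oo]
    --> (\int[@lebesgue_measure R]_x (f x)%:E)%E.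
Proof.
move=> fi; have mf := measurable_int _ fi.
under eq_cvg do rewrite integral_mkcond.
have [] := @dominated_convergence _ _ _ (@lebesgue_measure R) _ measurableT
  (fun n : nat => (EFin \o f) \_ `[- n%:R, n%:R]) (EFin \o f) (fun x => `|(f x)%:E|%E) => //.
- move=> n; apply/(measurable_restrictT _ _).1 => //.
  exact: measurable_funTS.
- apply/aeW => x _; apply: cvg_near_cst.
  exists (Num.bound `|x|) => // n /= xn.
  rewrite patchE ifT// inE/= in_itv/= -ler_norml.
  apply/ltW/(lt_le_trans (archi_boundP (normr_ge0 x))).
  by rewrite ler_nat.
- exact: integrable_abse.
- apply/aeW => x n _; rewrite patchE; case: ifPn => //= _.
  by rewrite normr0 lee_fin.
Qed.

(** * Moment recursion by integration by parts *)

Section normal_moment_recursion.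
Context {R : realType} (s : R).
Hypothesis s0 : s != 0.
Local Notation mu := (@lebesgue_measure R).
Local Notation pdf := (normal_pdf 0 s).

(** The derivative [f] of [x ^+ n * pdf x] integrates to 0 over the line because the boundary terms
    vanish; its two terms are multiples of the two moments. *)
Lemma normal_momentS n :
  normal_moment s n.+1 = s ^+ 2 * (n%:R * normal_moment s n.-1).
Proof.
pose F (x : R) := x ^+ n * pdf x.
pose f (x : R) := n%:R * (x ^+ n.-1 * pdf x) - (s ^+ 2)^-1 * (x ^+ n.+1 * pdf x).
have dF (x : R) : is_derive x 1 F (f x) := is_derive_expr_normal_pdf s0 n x.
have i1 k (c : R) : mu.-integrable setT (EFin \o (fun x => c * (x ^+ k * pdf x))).
  by apply: eq_integrable (integrableZl measurableT c (integrable_expr_normal_pdf s0 k)).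
have fi : mu.-integrable setT (EFin \o f).
  by apply: eq_integrable (integrableB measurableT (i1 _ _) (i1 _ _)).
have cF : continuous F.
  by move=> x; apply/differentiable_continuous/derivable1_diffP; exact: ex_derive.
have cf : continuous f.
  move=> x; apply: cvgB; apply: cvgMr; apply: cvgM;
    by [exact: exprn_continuous|exact: continuous_normal_pdf].
have If0 : (\int[mu]_x (f x)%:E = 0)%E.
  have := cvg_integral_symitv fi; rewrite -cvg_shiftS/= => /cvg_lim <-//.
  (* Starting at [k.+1] keeps the interval nondegenerate. The endpoints are written [1 * k] and
     [-1 * k] to match the decay lemma with [e = 1] and [e = -1]. *)
  have FTC k : (\int[mu]_(x in `[(- k.+1%:R)%R, k.+1%:R%R]) (f x)%:E =
      (F (1 * k.+1%:R) - F (-1 * k.+1%:R))%:E)%E.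
    rewrite (@continuous_FTC2 _ f F) => //; first by rewrite mul1r mulN1r.
    - by rewrite (@lt_trans _ _ 0) ?oppr_lt0.
    - exact: continuous_subspaceT.
    - split => [x _ | |]; first exact: ex_derive.
        by apply: cvg_at_right_filter; exact: cF.
      by apply: cvg_at_left_filter; exact: cF.
    - by move=> x _; rewrite derive1E; exact: derive_val.
  under eq_fun do rewrite FTC.
  apply/cvg_lim => //.
  have := cvg_shiftS (fun k : nat => (F (1 * k%:R) - F (-1 * k%:R))%:E) => /= ->.
  apply: cvg_EFin; first exact: nearW.
  rewrite -[0]subr0; apply: cvgB; apply: cvg_expr_normal_pdf => //.
    by rewrite normr1.
  by rewrite normrN1.
have : \int[mu]_x f x = 0 by rewrite /Rintegral If0.
rewrite /f RintegralB// !RintegralZl//; try exact: integrable_expr_normal_pdf.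
rewrite -!(normal_momentE s0) => /subr0_eq ->.
by rewrite mulrA divff ?mul1r// sqrf_eq0.
Qed.
End normal_moment_recursion.

(** * Products of independent random variables *)

Section independence.
Context {R : realType} {dT : measure_display} {T : measurableType dT}.
Variables (P : probability T R) (N : probability (measurableTypeR R) R).
Context {I : choiceType}.
Variable g : I -> T -> R.
Hypothesis mg : forall i, measurable_fun setT (g i).
Hypothesis indep : forall (J : seq I) (A : I -> set R), uniq J ->
  (forall i, measurable (A i)) ->
  P (\bigcap_(i in [set i | i \in J]) (g i @^-1` A i)) = (\prod_(i <- J) N (A i))%E.

Let measurable_prod_comp (J : seq I) (f : I -> R -> R) :
  (forall i, measurable_fun setT (f i)) ->
  measurable_fun setT (fun w => \prod_(i <- J) f i (g i w)).
Proof.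
by move=> mf; apply: measurable_prod => i _; apply: measurableT_comp; [exact: mf|exact: mg].
Qed.

(* Induction on J1: by the induction hypothesis the measure A |-> E[1_A(g_k) G], where G is
   the product over the other indices, is a multiple of N, so the indicator of A at k may be
   replaced by f k. *)
Let ge0_indep_prod_indic (J1 J2 : seq I) (f : I -> R -> R) (A : I -> set R) :
  uniq (J1 ++ J2) -> (forall i, measurable (A i)) ->
  (forall i, measurable_fun setT (f i)) -> (forall i x, 0 <= f i x) ->
  (forall i, N.-integrable setT (EFin \o f i)) ->
  (\int[P]_w ((\prod_(i <- J1) f i (g i w)) * \prod_(i <- J2) \1_(A i) (g i w))%:E =
   ((\prod_(i <- J1) \int[N]_x f i x) * \prod_(i <- J2) fine (N (A i)))%:E)%E.
Proof.
move=> + + mf f0 fi; elim: J1 J2 A => [J2 A uJ mA | k J1 IH J2 A].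
  (* With indicators only, the product is the indicator of an intersection, and [indep] applies
     directly. *)
  rewrite big_nil mul1r.
  transitivity (\int[P]_w (\1_(\bigcap_(i in [set i | i \in J2]) (g i @^-1` A i)) w)%:E)%E.
    apply: eq_integral => w _; rewrite big_nil mul1r; congr EFin.
    rewrite bigcap_seq; elim: (J2) => [|j J2' IHJ].
      by rewrite !big_nil indicE in_setT.
    by rewrite !big_cons indicI /= -IHJ.
  rewrite integral_indic ?setIT//; last first.
    apply: fin_bigcap_measurable => [|i _]; first exact: finite_seq.
    by rewrite -[_ @^-1` _]setTI; exact: mg.
  rewrite [LHS](indep uJ mA) -prodEFin; apply: eq_bigr => i _.
  by rewrite fineK//; apply: fin_num_measure; exact: mA.
rewrite cat_cons cons_uniq mem_cat negb_or => /andP[/andP[kJ1 kJ2] uJ] mA.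
pose G w := (\prod_(i <- J1) f i (g i w)) * \prod_(i <- J2) \1_(A i) (g i w).
pose c := (\prod_(i <- J1) \int[N]_x f i x) * \prod_(i <- J2) fine (N (A i)).
(* Nonnegativity makes [c] times [N] a measure, as the density lemma requires. *)
have c0 : 0 <= c.
  rewrite mulr_ge0// prodr_ge0// => i _; last by rewrite fine_ge0.
  by apply: Rintegral_ge0.
transitivity (\int[P]_w ((f k (g k w))%:E * (G w)%:E))%E.
  by apply: eq_integral => w _; rewrite big_cons -mulrA EFinM.
rewrite -(@ge0_integral_density _ _ _ _ _ P (mscale (NngNum c0) N) (g k) G
  _ _ _ _ (EFin \o f k)) => //; last 6 first.
- exact: mg.
- apply: measurable_funM; first exact: (measurable_prod_comp J1 mf).
  by apply: (measurable_prod_comp J2 (f := fun i => \1_(A i))) => i; exact: measurable_indic.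
- move=> w; rewrite /G mulr_ge0// prodr_ge0// => i _; exact: f0.
- move=> B mB; rewrite /mscale/= /c.
  (* The index [k] moves into the indicator list with the set [B]; since [k] is not in [J2], the
     other sets are unchanged. *)
  pose A' i := if i == k then B else A i.
  have eJ2 (F : I -> set R -> R) : \prod_(i <- k :: J2) F i (A' i) =
      F k B * \prod_(i <- J2) F i (A i).
    rewrite big_cons /A' eqxx; congr (_ * _); rewrite !big_seq.
    by apply: eq_bigr => i iJ; rewrite ifF//; apply: contraNF kJ2 => /eqP <-.
  have := IH (k :: J2) A'; rewrite (eJ2 (fun _ X => fine (N X))).
  under eq_integral => w _ do rewrite (eJ2 (fun i X => \1_X (g i w))).
  move=> IHk; transitivity (\int[P]_w ((\prod_(i <- J1) f i (g i w)) *
      (\1_B (g k w) * \prod_(i <- J2) \1_(A i) (g i w)))%:E)%E; last first.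
    by apply: eq_integral => w _; rewrite mulrCA.
  rewrite IHk.
  - have NB : N B \is a fin_num by exact: fin_num_measure.
    by rewrite -[X in (_ * X)%E = _](fineK NB) -EFinM; congr EFin; rewrite -[LHS]/(c * _) /c; ring.
  - by rewrite uniq_catC cat_cons cons_uniq mem_cat negb_or kJ1 kJ2 uniq_catC.
  - by move=> i; rewrite /A'; case: ifP.
- by apply/measurable_EFinP; exact: mf.
- by move=> y; rewrite lee_fin; exact: f0.
rewrite ge0_integral_mscale//; last 2 first.
- by apply/measurable_EFinP; exact: mf.
- by move=> x _; rewrite lee_fin; exact: f0.
rewrite big_cons -mulrA -/c [RHS]EFinM muleC; congr (_ * _)%E.
rewrite /Rintegral fineK//; first by exact: (integrable_fin_num measurableT (fi k)).
Qed.

Let ge0_indep_prod (J : seq I) (f : I -> R -> R) :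
  uniq J -> (forall i, measurable_fun setT (f i)) -> (forall i x, 0 <= f i x) ->
  (forall i, N.-integrable setT (EFin \o f i)) ->
  (\int[P]_w (\prod_(i <- J) f i (g i w))%:E = (\prod_(i <- J) \int[N]_x f i x)%:E)%E.
Proof.
move=> uJ mf f0 fi.
have := @ge0_indep_prod_indic J [::] f (fun=> setT).
rewrite cats0 big_nil mulr1 => <- //.
by apply: eq_integral => w _; rewrite big_nil mulr1.
Qed.

(** The nonnegative case applied to the functions [|f i|] gives a finite product, so integrability
    of the factors suffices. *)
Lemma integrable_indep_prod (J : seq I) (f : I -> R -> R) :
  uniq J -> (forall i, measurable_fun setT (f i)) ->
  (forall i, N.-integrable setT (EFin \o f i)) ->
  P.-integrable setT (EFin \o (fun w => \prod_(i <- J) f i (g i w))).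
Proof.
move=> uJ mf fi; apply/integrableP; split.
  by apply/measurable_EFinP; exact: (measurable_prod_comp J mf).
under eq_integral do rewrite /= normr_prod.
have := @ge0_indep_prod J (fun i x => `|f i x|) uJ.
move=> -> //; first exact: ltry.
  by move=> i; apply: measurableT_comp => //; exact: mf.
by move=> i; exact: (integrable_abse (fi i)).
Qed.

Lemma Rintegral_indep_prod (J : seq I) (f : I -> R -> R) :
  uniq J -> (forall i, measurable_fun setT (f i)) ->
  (forall i, N.-integrable setT (EFin \o f i)) ->
  \int[P]_w (\prod_(i <- J) f i (g i w)) = \prod_(i <- J) \int[N]_x f i x.
Proof.
(* Only the indices in J1 may carry functions of varying sign; they are removed one at a time
   by writing f k = (f k + |f k|) - |f k|. *)
rewrite -[J]cats0; have : {in [::], forall i x, 0 <= f i x} by [].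
elim: J [::] f => [|k J1 IH] J2 f f0 uJ mf fi.
  have eJ F : \prod_(i <- J2) F i (f i) = \prod_(i <- J2) F i (fun x => `|f i x|) :> R.
    apply: eq_big_seq => i iJ; congr (F i _).
    by apply/funext => x; rewrite ger0_norm// f0.
  rewrite (eJ (fun i h => \int[N]_x h x)) /=.
  under eq_Rintegral do rewrite (eJ (fun i h => h (g i _))).
  rewrite /Rintegral (@ge0_indep_prod J2 (fun i x => `|f i x|))//.
    by move=> i; apply: measurableT_comp => //; exact: mf.
  by move=> i; exact: (integrable_abse (fi i)).
have [kJ uJ'] : k \notin J1 ++ J2 /\ uniq (J1 ++ J2) by apply/andP.
pose rest w := \prod_(i <- J1 ++ J2) f i (g i w).
(* [upd h] puts [h] in the place of [f k]. For nonnegative [h] the index [k] can join [J2], where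
   the induction hypothesis applies. *)
pose upd (h : R -> R) i := if i == k then h else f i.
have eJ (F : I -> (R -> R) -> R) h : \prod_(i <- J1 ++ k :: J2) F i (upd h i) =
    F k h * \prod_(i <- J1 ++ J2) F i (f i).
  rewrite (perm_big (k :: J1 ++ J2)) /=; last by rewrite perm_catC/= perm_cons perm_catC.
  rewrite big_cons /upd eqxx; congr (_ * _).
  by apply: eq_big_seq => i iJ; rewrite ifF//; apply: contraNF kJ => /eqP <-.
have updE (h : R -> R) : (forall x, 0 <= h x) -> measurable_fun setT h ->
    N.-integrable setT (EFin \o h) ->
    P.-integrable setT (EFin \o (fun w => h (g k w) * rest w)) /\
    \int[P]_w (h (g k w) * rest w) = (\int[N]_x h x) * \prod_(i <- J1 ++ J2) \int[N]_x f i x.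
  move=> h0 mh hi.
  have uJk : uniq (J1 ++ k :: J2).
    by rewrite uniq_catC cat_cons cons_uniq mem_cat orbC -mem_cat kJ uniq_catC.
  have mu i : measurable_fun setT (upd h i) by rewrite /upd; case: ifP.
  have iu i : N.-integrable setT (EFin \o upd h i) by rewrite /upd; case: ifP.
  have eP w : h (g k w) * rest w = \prod_(i <- J1 ++ k :: J2) upd h i (g i w).
    by rewrite (eJ (fun i l => l (g i w))).
  split.
    by under eq_fun do rewrite eP; exact: integrable_indep_prod.
  under eq_Rintegral do rewrite eP.
  rewrite IH// ?(eJ (fun i l => \int[N]_x l x))//.
  move=> i; rewrite inE /upd => /predU1P[->|iJ2]; first by rewrite eqxx.
  by case: ifP => // _; exact: f0.
have mn : measurable_fun setT (fun x => `|f k x|).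
  by apply: measurableT_comp => //; exact: mf.
have ni : N.-integrable setT (EFin \o (fun x => `|f k x|)) by exact: (integrable_abse (fi k)).
have mp : measurable_fun setT (fun x => f k x + `|f k x|).
  by apply: measurable_funD => //; exact: mf.
have pi : N.-integrable setT (EFin \o (fun x => f k x + `|f k x|)).
  by have := integrableD measurableT (fi k) ni.
have [i1 e1] := updE _ (fun x => normr_ge0 _) mn ni.
have p0 x : 0 <= f k x + `|f k x| by have := ler_norm (- f k x); rewrite normrN; lra.
have [i2 e2] := updE _ p0 mp pi.
rewrite cat_cons big_cons; under eq_Rintegral do rewrite big_cons.
have -> : \int[P]_w (f k (g k w) * \prod_(i <- J1 ++ J2) f i (g i w)) =
    \int[P]_w ((f k (g k w) + `|f k (g k w)|) * rest w - `|f k (g k w)| * rest w).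
  by apply: eq_Rintegral => w _; rewrite -/(rest w); ring.
rewrite RintegralB// e1 e2 RintegralD//. ring.
Qed.

End independence.

(** * Polynomials in independent normal variables *)

Section gaussian_polynomials.
Context {R : realType} {dT : measure_display} {T : measurableType dT}.
Variable P : probability T R.
Context {I : choiceType}.
Variables (g : I -> T -> R) (s : R).
Hypotheses (s0 : s != 0) (hg : iid_normal P g 0 s).

Local Notation word m w := (\prod_(i <- m) g i w).
Local Notation poly p w := (\sum_(c <- p) c.1 * word c.2 w).

(** Grouping repeated letters gives a product over distinct indices, the form that independence
    handles. *)
Let word_count (m : seq I) w : word m w = \prod_(i <- undup m) g i w ^+ count_mem i m.
Proof. by rewrite -big_undup_iterop_count. Qed.

Lemma integrable_word (m : seq I) : P.-integrable setT (EFin \o (fun w => word m w)).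
Proof.
case: hg => mg indep; under eq_fun do rewrite /= word_count.
apply: (integrable_indep_prod mg indep (f := fun i x => x ^+ count_mem i m)).
- exact: undup_uniq.
- by move=> i; exact: measurable_funX.
- by move=> i; exact: integrable_expr_normal.
Qed.

Lemma Rintegral_word (m : seq I) :
  \int[P]_w word m w = \prod_(i <- undup m) normal_moment s (count_mem i m).
Proof.
case: hg => mg indep; under eq_Rintegral do rewrite word_count.
apply: (Rintegral_indep_prod mg indep (f := fun i x => x ^+ count_mem i m)).
- exact: undup_uniq.
- by move=> i; exact: measurable_funX.
- by move=> i; exact: integrable_expr_normal.
Qed.

Lemma Rintegral_word_cat (m1 m2 : seq I) : ~~ has [in m1] m2 ->
  \int[P]_w word (m1 ++ m2) w = (\int[P]_w word m1 w) * \int[P]_w word m2 w.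
Proof.
move=> m12; have dis i : i \in m2 -> i \notin m1 by move: i; exact/hasPn.
rewrite !Rintegral_word.
rewrite (perm_big (undup m1 ++ undup m2)); last first.
  apply: uniq_perm; rewrite ?undup_uniq ?cat_uniq ?undup_uniq ?andbT//=.
    by apply/hasPn => i; rewrite !mem_undup => /dis.
  by move=> i; rewrite mem_undup !mem_cat !mem_undup.
rewrite big_cat; congr (_ * _); apply: eq_big_seq => i; rewrite mem_undup => im;
  rewrite count_cat.
- rewrite [X in (_ + X)%N](count_memPn _) ?addn0//.
  by apply: contraL im => /dis.
- by rewrite [X in (X + _)%N](count_memPn _)// dis.
Qed.

Lemma Rintegral_sum (S : Type) (r : seq S) (F : S -> T -> R) :
  (forall i, P.-integrable setT (EFin \o F i)) ->
  P.-integrable setT (EFin \o (fun w => \sum_(i <- r) F i w)) /\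
  \int[P]_w (\sum_(i <- r) F i w) = \sum_(i <- r) \int[P]_w F i w.
Proof.
move=> Fi; elim: r => [|i r [i1 e1]].
  split; first by under eq_fun do rewrite /= big_nil; exact: integrable0.
  by under eq_Rintegral do rewrite big_nil; rewrite Rintegral_cst// mul0r big_nil.
split.
  apply: eq_integrable (integrableD measurableT (Fi i) i1) => // w _.
  by rewrite /= big_cons.
under eq_Rintegral do rewrite big_cons.
by rewrite RintegralD// e1 big_cons.
Qed.

Lemma integrable_scale (c : R) (F : T -> R) : P.-integrable setT (EFin \o F) ->
  P.-integrable setT (EFin \o (fun w => c * F w)).
Proof.
by move=> Fi; apply: eq_integrable (integrableZl measurableT c Fi).
Qed.

Let integrable_scale_word (c : R * seq I) :
  P.-integrable setT (EFin \o (fun w => c.1 * word c.2 w)).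
Proof. exact/integrable_scale/integrable_word. Qed.

Let pmul (p q : seq (R * seq I)) := [seq (a.1 * b.1, a.2 ++ b.2) | a <- p, b <- q].

Let pmulE p q w : poly (pmul p q) w = poly p w * poly q w.
Proof.
rewrite big_allpairs_dep mulr_suml; apply: eq_bigr => a _; rewrite mulr_sumr.
by apply: eq_bigr => b _; rewrite /= big_cat/=; ring.
Qed.

(* A polynomial in the g_i is encoded as a list of pairs (coefficient, word of indices). *)
Definition gpoly (J : {pred I}) (F : T -> R) :=
  exists2 p : seq (R * seq I), all (fun c => all [in J] c.2) p &
    forall w, F w = poly p w.

Lemma gpoly_cst J (a : R) : gpoly J (fun=> a).
Proof. by exists [:: (a, [::])] => // w; rewrite big_seq1 big_nil mulr1. Qed.

Lemma gpoly_var (J : {pred I}) i : i \in J -> gpoly J (g i).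
Proof.
move=> iJ; exists [:: (1, [:: i])]; first by rewrite /= iJ.
by move=> w; rewrite !big_seq1 mul1r.
Qed.

Lemma gpolyD J F G : gpoly J F -> gpoly J G -> gpoly J (fun w => F w + G w).
Proof.
move=> [p pJ Fp] [q qJ Gq]; exists (p ++ q); first by rewrite all_cat pJ.
by move=> w; rewrite big_cat/= Fp Gq.
Qed.

Lemma gpolyM J F G : gpoly J F -> gpoly J G -> gpoly J (fun w => F w * G w).
Proof.
move=> [p pJ Fp] [q qJ Gq]; exists (pmul p q).
  apply/all_allpairsP => a b ap bq /=; rewrite all_cat.
  by rewrite (allP pJ _ ap) (allP qJ _ bq).
by move=> w; rewrite pmulE Fp Gq.
Qed.

Lemma gpolyX J F n : gpoly J F -> gpoly J (fun w => F w ^+ n).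
Proof.
move=> hF; elim: n => [|n IH].
  by under eq_fun do rewrite expr0; exact: gpoly_cst.
by under eq_fun do rewrite exprS; exact: gpolyM.
Qed.

Lemma gpoly_sum J (S : Type) (r : seq S) (F : S -> T -> R) :
  (forall i, gpoly J (F i)) -> gpoly J (fun w => \sum_(i <- r) F i w).
Proof.
move=> hF; elim: r => [|i r IH].
  by under eq_fun do rewrite big_nil; exact: gpoly_cst.
by under eq_fun do rewrite big_cons; exact: gpolyD.
Qed.

Lemma gpoly_integrable J F : gpoly J F -> P.-integrable setT (EFin \o F).
Proof.
move=> [p _ Fp]; rewrite (_ : F = fun w => poly p w); last exact/funext.
by have [] := @Rintegral_sum _ p (fun c w => c.1 * word c.2 w) integrable_scale_word.
Qed.

Let Rintegral_poly p : \int[P]_w poly p w = \sum_(c <- p) c.1 * \int[P]_w word c.2 w.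
Proof.
have [_ ->] := @Rintegral_sum _ p (fun c w => c.1 * word c.2 w) integrable_scale_word.
by apply: eq_bigr => c _; rewrite RintegralZl//; exact: integrable_word.
Qed.

(** After expansion into monomials, each word of [F] shares no letter with a word of [G], so
    expectations of concatenated words factor. *)
Lemma gpoly_indep (J J' : {pred I}) F G : (forall i, i \in J -> i \in J' -> False) ->
  gpoly J F -> gpoly J' G ->
  \int[P]_w (F w * G w) = (\int[P]_w F w) * \int[P]_w G w.
Proof.
move=> JJ' [p pJ Fp] [q qJ Gq].
under eq_Rintegral do rewrite Fp Gq -pmulE.
rewrite Rintegral_poly.
under [in RHS]eq_Rintegral do rewrite Fp.
under [X in _ * X]eq_Rintegral do rewrite Gq.
rewrite !Rintegral_poly big_allpairs_dep mulr_suml; apply: eq_big_seq => a ap.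
rewrite mulr_sumr; apply: eq_big_seq => b bq /=.
rewrite Rintegral_word_cat; first by ring.
apply/hasPn => i /(allP (allP qJ _ bq)) iJ'; apply/negP.
by move=> /(allP (allP pJ _ ap)) /= /JJ'; apply.
Qed.

(** The formal derivative of a monomial in the direction [v], by the product rule, evaluated at the
    outcome. *)
Fixpoint dword (v : I -> R) (m : seq I) (w : T) : R :=
  if m is i :: m' then v i * word m' w + g i w * dword v m' w else 0.

Let dword_cat v m1 m2 w :
  dword v (m1 ++ m2) w = dword v m1 w * word m2 w + word m1 w * dword v m2 w.
Proof.
elim: m1 => [|i m1 IH] /=; first by rewrite big_nil; ring.
by rewrite IH big_cat big_cons /=; ring.
Qed.

(** A relation rather than an operator: a function of the outcome may have several polynomial
    representations, so one list must witness both [F] and its derivative. *)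
Definition gderiv (v : I -> R) (F F' : T -> R) :=
  exists2 p : seq (R * seq I), forall w, F w = poly p w &
    forall w, F' w = \sum_(c <- p) c.1 * dword v c.2 w.

Lemma gderiv_cst v (a : R) : gderiv v (fun=> a) (fun=> 0).
Proof.
by exists [:: (a, [::])] => w; rewrite big_seq1 ?big_nil ?mulr1 ?mulr0.
Qed.

Lemma gderiv_var v i : gderiv v (g i) (fun=> v i).
Proof.
by exists [:: (1, [:: i])] => w; rewrite !big_seq1/= ?big_nil mul1r// mulr1 mulr0 addr0.
Qed.

Lemma gderivD v F F' G G' : gderiv v F F' -> gderiv v G G' ->
  gderiv v (fun w => F w + G w) (fun w => F' w + G' w).
Proof.
move=> [p Fp F'p] [q Gq G'q]; exists (p ++ q) => w; rewrite big_cat/=.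
  by rewrite Fp Gq.
by rewrite F'p G'q.
Qed.

Lemma gderivM v F F' G G' : gderiv v F F' -> gderiv v G G' ->
  gderiv v (fun w => F w * G w) (fun w => F' w * G w + F w * G' w).
Proof.
move=> [p Fp F'p] [q Gq G'q]; exists (pmul p q) => w.
  by rewrite pmulE Fp Gq.
rewrite big_allpairs_dep Fp Gq F'p G'q !mulr_suml -big_split; apply: eq_bigr => a _ /=.
rewrite !mulr_sumr -big_split; apply: eq_bigr => b _ /=; rewrite dword_cat; ring.
Qed.

Lemma gderivX v F F' n : gderiv v F F' ->
  gderiv v (fun w => F w ^+ n) (fun w => n%:R * F w ^+ n.-1 * F' w).
Proof.
move=> hF; elim: n => [|n IH].
  under eq_fun do rewrite expr0.
  by under [X in gderiv _ _ X]eq_fun do rewrite !mul0r; exact: gderiv_cst.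
under eq_fun do rewrite exprS.
rewrite (_ : (fun w => n.+1%:R * _ * _) =
  (fun w => F' w * F w ^+ n + F w * (n%:R * F w ^+ n.-1 * F' w))); first exact: gderivM.
apply/funext => w /=; rewrite -natr1; case: n {IH} => [|n]; first by rewrite expr0; ring.
by rewrite exprS; ring.
Qed.

Lemma gderiv_sum v (S : Type) (r : seq S) (F F' : S -> T -> R) :
  (forall i, gderiv v (F i) (F' i)) ->
  gderiv v (fun w => \sum_(i <- r) F i w) (fun w => \sum_(i <- r) F' i w).
Proof.
move=> hF; elim: r => [|i r IH].
  under eq_fun do rewrite big_nil.
  by under [X in gderiv _ _ X]eq_fun do rewrite big_nil; exact: gderiv_cst.
under eq_fun do rewrite big_cons.
by under [X in gderiv _ _ X]eq_fun do rewrite big_cons; exact: gderivD.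
Qed.

Let Rintegral_word_nseq_cat k n (m : seq I) : k \notin m ->
  \int[P]_w word (nseq n k ++ m) w = normal_moment s n * \int[P]_w word m w.
Proof.
move=> km; rewrite Rintegral_word_cat; last first.
  by apply/hasPn => i im /=; rewrite mem_nseq; apply/nandP; right; apply: contraNN km => /eqP <-.
congr (_ * _); rewrite Rintegral_word; case: n => [|n]; first by rewrite big_nil normal_moment0.
have pk : perm_eq (undup (nseq n.+1 k)) [:: k].
  by apply: uniq_perm => [|//|i]; [exact: undup_uniq|rewrite mem_undup mem_nseq inE].
by rewrite (perm_big _ pk) big_seq1 count_nseq/= eqxx mul1n.
Qed.

(** Stein's identity for a monomial and one variable. Collecting the [n] copies of [k] in front,
    independence reduces it to the recursion between the moments of orders [n.+1] and [n.-1]. *)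
Lemma stein_word k (m : seq I) : \int[P]_w (g k w * word m w) =
  s ^+ 2 * ((count_mem k m)%:R * \int[P]_w word (rem k m) w).
Proof.
pose n := count_mem k m; pose m' := [seq i <- m | i != k].
have km' : k \notin m' by rewrite mem_filter eqxx.
have pm : perm_eq m (nseq n k ++ m').
  rewrite -(perm_filterC (pred1 k) m) perm_cat2r.
  by rewrite /n -size_filter -(all_pred1P _ _ (filter_all (pred1 k) m)).
transitivity (\int[P]_w word (nseq n.+1 k ++ m') w).
  by apply: eq_Rintegral => w _; rewrite /= big_cons; congr (_ * _); exact: perm_big.
rewrite (Rintegral_word_nseq_cat n.+1 km') normal_momentS// -/n.
(* If [k] does not occur in [m], both sides vanish; otherwise [rem k m] has exactly [n.-1] copies of
   [k]. *)
case: (posnP n) => [->|n0]; first by rewrite !mul0r !mulr0 mul0r.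
rewrite -mulrA -mulrA; congr (_ * (_ * _)).
rewrite -(Rintegral_word_nseq_cat n.-1 km'); apply: eq_Rintegral => w _; apply: perm_big.
rewrite -(perm_cons k).
have -> : k :: nseq n.-1 k ++ m' = nseq n k ++ m' by rewrite -[in RHS](prednK n0).
rewrite perm_sym; apply: (perm_trans _ pm); rewrite perm_sym; apply: perm_to_rem.
by rewrite -has_pred1 has_count.
Qed.

End gaussian_polynomials.

(** * Stein's identity for polynomials *)

Section stein.
Context {R : realType} {dT : measure_display} {T : measurableType dT}.
Variable P : probability T R.
Context {I : finType}.
Variables (g : I -> T -> R) (s : R).
Hypotheses (s0 : s != 0) (hg : iid_normal P g 0 s).
Local Notation word m w := (\prod_(i <- m) g i w).

(** Rewrites the product rule as a sum of partial derivatives, matching the right-hand side of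
    [stein_word]. *)
Let dwordE v (m : seq I) w :
  dword g v m w = \sum_k v k * ((count_mem k m)%:R * word (rem k m) w).
Proof.
elim: m => [|i m IH] /=; first by rewrite big1// => k _; rewrite mul0r mulr0.
rewrite IH mulr_sumr (bigD1 i)//= [RHS](bigD1 i)//= eqxx.
rewrite addrA; congr (_ + _).
  case: (boolP (i \in m)) => im.
    by rewrite (perm_big _ (perm_to_rem im)) big_cons natrD /=; ring.
  by rewrite (count_memPn im) /=; ring.
apply: eq_bigr => k ki; rewrite eq_sym (negbTE ki) big_cons add0n; ring.
Qed.

Let integrable_dword v m : P.-integrable setT (EFin \o dword g v m).
Proof.
rewrite (_ : dword g v m = fun w =>
  \sum_(k <- index_enum I) v k * ((count_mem k m)%:R * word (rem k m) w)); last first.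
  by apply/funext => w; exact: dwordE.
apply: (proj1 (Rintegral_sum _ _)) => k; do 2 apply: integrable_scale.
exact: (integrable_word s0 hg).
Qed.

(** Both sides are linear in [v] and in the monomials of [F], so [stein_word] suffices; the
    integrability facts justify exchanging sums and integrals. *)
Lemma stein v (F F' : T -> R) : gderiv g v F F' ->
  \int[P]_w ((\sum_i v i * g i w) * F w) = s ^+ 2 * \int[P]_w F' w.
Proof.
move=> [p Fp F'p].
have iW := integrable_word s0 hg.
have iV k m : P.-integrable setT (EFin \o (fun w => v k * (g k w * word m w))).
  apply: integrable_scale; apply: eq_integrable (iW (k :: m)) => // w _ /=.
  by rewrite big_cons.
have iS m : P.-integrable setT (EFin \o (fun w => \sum_i v i * (g i w * word m w))).
  exact: (proj1 (Rintegral_sum (index_enum I) (fun i => iV i m))).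
have sumE m w : (\sum_i v i * g i w) * word m w = \sum_i v i * (g i w * word m w).
  by rewrite mulr_suml; apply: eq_bigr => i _; rewrite mulrA.
have -> : \int[P]_w ((\sum_i v i * g i w) * F w) =
    \int[P]_w (\sum_(c <- p) c.1 * \sum_i v i * (g i w * word c.2 w)).
  apply: eq_Rintegral => w _; rewrite Fp mulr_sumr; apply: eq_bigr => c _.
  by rewrite mulrCA sumE.
under [in RHS]eq_Rintegral do rewrite F'p.
rewrite (proj2 (Rintegral_sum p (fun c => integrable_scale c.1 (iS c.2)))).
rewrite (proj2 (Rintegral_sum p (fun c => integrable_scale c.1 (integrable_dword v c.2)))).
rewrite mulr_sumr; apply: eq_bigr => c _.
rewrite !RintegralZl//.
rewrite mulrCA; congr (_ * _).
rewrite (proj2 (Rintegral_sum (index_enum I) (fun i => iV i c.2))).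
under [in RHS]eq_Rintegral do rewrite dwordE.
rewrite (proj2 (Rintegral_sum (index_enum I) (fun k =>
  integrable_scale (v k) (integrable_scale (count_mem k c.2)%:R (iW (rem k c.2)))))).
rewrite mulr_sumr; apply: eq_bigr => k _.
rewrite !RintegralZl//; last first.
- by apply: eq_integrable (iW (k :: c.2)) => // w _ /=; rewrite big_cons.
- by apply: integrable_scale.
rewrite (stein_word s0 hg); ring.
Qed.

End stein.

(** * Moments of complex Gaussian linear forms *)

(** The recursion leaves the diagonal, so the closed form is needed for all [p] and [q]. Induction
    on [p]: the formula for [f p] gives one for [h p], and Pascal's rule then gives [f p.+1]. At
    [q = 0] the truncated [q.-1] has coefficient 0. *)
Lemma moment_recursion_solution (R : comNzRingType) (X Y c : R) (f h : nat -> nat -> R) :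
  f 0%N 0%N = 1 ->
  (forall q, f 0%N q.+1 = q.+1%:R * Y * f 0%N q) ->
  (forall p q, f p.+1 q = p.+1%:R * X * f p q + q%:R * c * h p q.-1) ->
  (forall p q, h p q = p.+1%:R * c * f p q + q%:R * Y * h p q.-1) ->
  forall p q, f p q = \sum_(i < p.+1) (p`! * q`! * 'C(p, i) * 'C(q, i))%:R *
    c ^+ (2 * i) * X ^+ (p - i) * Y ^+ (q - i).
Proof.
move=> f00 f0 fS hE.
have bS n k : 'C(n.+1, k.+1)%:R = 'C(n, k.+1)%:R + 'C(n, k)%:R :> R.
  by rewrite binS natrD.
elim=> [q|p IH].
  rewrite big_ord1 /= !bin0 fact0 muln0 !subn0 !expr0 !muln1 mul1n !mulr1.
  elim: q => [|q IH]; first by rewrite f00 expr0 mulr1.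
  by rewrite f0 IH exprS factS natrM; ring.
have hp q : h p q = \sum_(i < p.+1) (p.+1`! * q`! * 'C(p, i) * 'C(q.+1, i.+1))%:R *
    c ^+ (2 * i).+1 * X ^+ (p - i) * Y ^+ (q - i).
  elim: q => [|q IHq]; rewrite hE /= IH mulr_sumr.
    rewrite mul0r mul0r addr0; apply: eq_bigr => -[[|i] ip] _ /=.
      by rewrite !bin0 !bin1 !muln1 muln0 !subn0 expr0 expr1 factS !natrM; ring.
    by rewrite bin0n/= (@bin_small 1)// !(muln0, mul0n) !mul0r mulr0.
  rewrite IHq mulr_sumr -big_split; apply: eq_bigr => i _ /=.
  rewrite !factS !natrM (bS q.+1) exprS.
  (* For [q < i] the truncated exponents no longer shift by one, but the binomial coefficient of
     that term is 0. *)
  have [iq|qi] := leqP i q; first by rewrite subSn// exprS; ring.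
  by rewrite (@bin_small q.+1 i.+1)//; ring.
move=> [|q]; rewrite fS /=.
  rewrite IH mul0r mul0r addr0 big_ord_recl [in RHS]big_ord_recl /=.
  rewrite !bin0 !subn0 muln0 big1 ?big1 => [|i _|i _].
  - by rewrite !addr0 factS exprS !natrM; ring.
  - by rewrite /bump/= add1n bin0n/= muln0 !mul0r.
  - by rewrite /bump/= add1n bin0n/= muln0 !mul0r.
(* [u] is the target summand with ['C(p, i)] for ['C(p.+1, i)]. In Pascal's rule it supplies one
   half and the term in [h] the other; [u p.+1] vanishes. *)
pose u i : R := (p.+1`! * q.+1`! * 'C(p, i) * 'C(q.+1, i))%:R *
    c ^+ (2 * i) * X ^+ (p.+1 - i) * Y ^+ (q.+1 - i).
have -> : p.+1%:R * X * f p q.+1 = u 0%N + \sum_(i < p.+1) u i.+1.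
  have <- : \sum_(i < p.+2) u i = u 0%N + \sum_(i < p.+1) u i.+1.
    by rewrite big_ord_recl.
  rewrite big_ord_recr /= {2}/u bin_small// muln0 mul0n !mul0r addr0 IH mulr_sumr.
  apply: eq_bigr => i _; rewrite /u factS !natrM (subSn (leq_ord i)) exprS; ring.
rewrite [RHS]big_ord_recl -addrA; congr (_ + _).
  by rewrite /u /= !bin0.
rewrite hp mulr_sumr -big_split; apply: eq_bigr => i _ /=.
rewrite /u /bump/= add1n !subSS mulnS !factS !natrM (bS p).
rewrite exprS [c ^+ (2 + _)]exprD; ring.
Qed.

Lemma gpoly_abs2_xTu {R : realType} {dT : measure_display}
    {T : measurableType dT} {I : choiceType} (g : I -> T -> R)
    (J : {pred I}) (d : nat) (x : 'rV[R]_d) (a b : 'I_d -> T -> R) :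
  (forall j, gpoly g J (a j)) -> (forall j, gpoly g J (b j)) ->
  gpoly g J (abs2_xTu x a b).
Proof.
move=> aJ bJ; apply: gpolyD; apply: gpolyX; apply: gpoly_sum => j;
  by apply: gpolyM; [exact: gpoly_cst|].
Qed.

Section moments.
Context {R : realType} {dT : measure_display} {T : measurableType dT}.
Variables (P : probability T R) (d : nat) (a b : 'I_d -> T -> R).
Hypothesis hab : iid_CN P a b.

Local Notation g := (reim_family a b).
Let lin (x : 'rV[R]_d) (u : 'I_d -> T -> R) (w : T) : R := \sum_j x 0 j * u j w.

Let s0 : Num.sqrt 2^-1 != 0 :> R.
Proof. by rewrite gt_eqF// sqrtr_gt0 invr_gt0. Qed.

Let W (x : 'rV[R]_d) := abs2_xTu x a b.
Let V (x y : 'rV[R]_d) w := lin x a w * lin y a w + lin x b w * lin y b w.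

(** Directions in the space of all real variables: the linear form attached to [re z], respectively
    [im z], is the real, respectively imaginary, part of [z^T u]. *)
Let re (z : 'rV[R]_d) (i : 'I_d + 'I_d) := if i is inl j then z 0 j else 0.
Let im (z : 'rV[R]_d) (i : 'I_d + 'I_d) := if i is inr j then z 0 j else 0.

Let gpolyT F := gpoly g predT F.

Let gpoly_a x : gpolyT (lin x a).
Proof.
apply: gpoly_sum => j; apply: gpolyM; first exact: gpoly_cst.
exact: (@gpoly_var _ _ _ _ g predT (inl j)).
Qed.

Let gpoly_b x : gpolyT (lin x b).
Proof.
apply: gpoly_sum => j; apply: gpolyM; first exact: gpoly_cst.
exact: (@gpoly_var _ _ _ _ g predT (inr j)).
Qed.

Let gpoly_W x : gpolyT (W x).
Proof.
by apply: gpoly_abs2_xTu => j;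
  [exact: (@gpoly_var _ _ _ _ g predT (inl j))|exact: (@gpoly_var _ _ _ _ g predT (inr j))].
Qed.

Let gpoly_V x y : gpolyT (V x y).
Proof. by apply: gpolyD; apply: gpolyM; (exact: gpoly_a || exact: gpoly_b). Qed.

Let gderiv_lin (v : 'I_d + 'I_d -> R) (k : 'I_d -> 'I_d + 'I_d) (y : 'rV[R]_d) :
  gderiv g v (fun w => \sum_j y 0 j * g (k j) w) (fun=> \sum_j y 0 j * v (k j)).
Proof.
apply: gderiv_sum => j.
have := gderivM (gderiv_cst g v (y 0 j)) (gderiv_var g v (k j)).
by congr gderiv; apply/funext => w /=; rewrite mul0r add0r.
Qed.

Let dotrC (x y : 'rV[R]_d) : dotr x y = dotr y x.
Proof. by apply: eq_bigr => j _; rewrite mulrC. Qed.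

Let gderiv_re z y : gderiv g (re z) (lin y a) (fun=> dotr z y) /\
  gderiv g (re z) (lin y b) (fun=> 0).
Proof.
split; last first.
  have := @gderiv_lin (re z) inr y; congr gderiv; apply/funext => w.
  by rewrite big1// => j _; rewrite mulr0.
by have := @gderiv_lin (re z) inl y; rewrite dotrC.
Qed.

Let gderiv_im z y : gderiv g (im z) (lin y b) (fun=> dotr z y) /\
  gderiv g (im z) (lin y a) (fun=> 0).
Proof.
split; last first.
  have := @gderiv_lin (im z) inl y; congr gderiv; apply/funext => w.
  by rewrite big1// => j _; rewrite mulr0.
by have := @gderiv_lin (im z) inr y; rewrite dotrC.
Qed.

Let E F := \int[P]_w F w.

Let stein_re z F F' : gderiv g (re z) F F' -> E (fun w => lin z a w * F w) = 2^-1 * E F'.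
Proof.
move=> /(stein s0 hab); rewrite sqr_sqrtr ?invr_ge0// => <-.
apply: eq_Rintegral => w _; congr (_ * _); rewrite big_sumType/= [X in _ + X]big1 ?addr0//.
by move=> j _; rewrite mul0r.
Qed.

Let stein_im z F F' : gderiv g (im z) F F' -> E (fun w => lin z b w * F w) = 2^-1 * E F'.
Proof.
move=> /(stein s0 hab); rewrite sqr_sqrtr ?invr_ge0// => <-.
apply: eq_Rintegral => w _; congr (_ * _); rewrite big_sumType/= [X in X + _]big1 ?add0r//.
by move=> j _; rewrite mul0r.
Qed.

Let ED F G : gpolyT F -> gpolyT G -> E (fun w => F w + G w) = E F + E G.
Proof.
move=> hF hG.
by rewrite /E (RintegralD _ (gpoly_integrable s0 hab hF) (gpoly_integrable s0 hab hG)).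
Qed.

Let EZ c F : gpolyT F -> E (fun w => c * F w) = c * E F.
Proof. by move=> hF; rewrite /E (RintegralZl _ _ (gpoly_integrable s0 hab hF)). Qed.

Let gpoly_WW x y p q : gpolyT (fun w => W x w ^+ p * W y w ^+ q).
Proof. by apply: gpolyM; apply: gpolyX; exact: gpoly_W. Qed.

(** Stein's identity is applied to the real and imaginary parts of [z^T u] and the results are
    added. Since [V x x] is [W x], taking [z = x] and [z = y] gives both recursions at once. *)
Let E_V x y z p q :
  E (fun w => V z x w * (W x w ^+ p * W y w ^+ q)) =
  p.+1%:R * dotr z x * E (fun w => W x w ^+ p * W y w ^+ q) +
  q%:R * dotr z y * E (fun w => V x y w * (W x w ^+ p * W y w ^+ q.-1)).
Proof.
have [dxa dxb] := gderiv_re z x; have [dya dyb] := gderiv_re z y.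
have [exb exa] := gderiv_im z x; have [eyb eya] := gderiv_im z y.
have dW := gderivM (gderivX p (gderivD (gderivX 2 dxa) (gderivX 2 dxb)))
  (gderivX q (gderivD (gderivX 2 dya) (gderivX 2 dyb))).
have eW := gderivM (gderivX p (gderivD (gderivX 2 exa) (gderivX 2 exb)))
  (gderivX q (gderivD (gderivX 2 eya) (gderivX 2 eyb))).
have Da := stein_re (gderivM dxa dW).
have Db := stein_im (gderivM exb eW).
have pV u v : gpolyT (fun w => V u v w) by exact: gpoly_V.
have qa : gpolyT (fun w => lin z a w * (lin x a w * (W x w ^+ p * W y w ^+ q))).
  by apply: gpolyM (gpoly_a z) (gpolyM (gpoly_a x) (gpoly_WW x y p q)).
have qb : gpolyT (fun w => lin z b w * (lin x b w * (W x w ^+ p * W y w ^+ q))).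
  by apply: gpolyM (gpoly_b z) (gpolyM (gpoly_b x) (gpoly_WW x y p q)).
transitivity (E (fun w => lin z a w * (lin x a w * (W x w ^+ p * W y w ^+ q))) +
  E (fun w => lin z b w * (lin x b w * (W x w ^+ p * W y w ^+ q)))).
  by rewrite -ED//; apply: eq_Rintegral => w _; rewrite /V; ring.
(* The common shape of the two derivatives, with [u] either [a] or [b]. The factors 2 come from
   differentiating squares and cancel the variance [1 / 2]. *)
pose D u w := dotr z x * (W x w ^+ p * W y w ^+ q) +
  (p%:R * 2 * dotr z x * (lin x u w * lin x u w * (W x w ^+ p.-1 * W y w ^+ q)) +
  q%:R * 2 * dotr z y * (lin x u w * lin y u w * (W x w ^+ p * W y w ^+ q.-1))).
have gD u : (forall x, gpolyT (lin x u)) -> gpolyT (D u).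
  move=> hu; apply: gpolyD; first exact: (gpolyM (gpoly_cst _ _ _) (gpoly_WW _ _ _ _)).
  apply: gpolyD; apply: (gpolyM (gpoly_cst _ _ _));
    by apply: gpolyM (gpolyM (hu _) (hu _)) (gpoly_WW _ _ _ _).
have -> : E (fun w => lin z a w * (lin x a w * (W x w ^+ p * W y w ^+ q))) = 2^-1 * E (D a).
  rewrite [LHS]Da; congr (_ * _); apply: eq_Rintegral => w _.
  by rewrite /D /W /abs2_xTu -/(lin _ _ _) /= !expr1; ring.
have -> : E (fun w => lin z b w * (lin x b w * (W x w ^+ p * W y w ^+ q))) = 2^-1 * E (D b).
  rewrite [LHS]Db; congr (_ * _); apply: eq_Rintegral => w _.
  by rewrite /D /W /abs2_xTu -/(lin _ _ _) /= !expr1; ring.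
rewrite -mulrDr -ED; [|exact: gD|exact: gD].
have hM := gpoly_WW x y p q.
have hV : gpolyT (fun w => V x y w * (W x w ^+ p * W y w ^+ q.-1)).
  exact: gpolyM (gpoly_V _ _) (gpoly_WW _ _ _ _).
have hZ c F : gpolyT F -> gpolyT (fun w => c * F w).
  by move=> hF; apply: gpolyM hF; exact: gpoly_cst.
have hDD : gpolyT (fun w => D a w + D b w) by apply: gpolyD; exact: gD.
rewrite -(EZ _ hDD) -(EZ _ hM) -(EZ _ hV) -(ED (hZ _ _ hM) (hZ _ _ hV)).
apply: eq_Rintegral => w _; rewrite /D.
(* The factor [p] makes the identity hold at [p = 0] as well. It turns the coefficient 1 into
   [p.+1]. *)
have pE : p%:R * (W x w ^+ p.-1 * (lin x a w ^+ 2 + lin x b w ^+ 2)) = p%:R * W x w ^+ p.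
  by case: (p) => [|n]; rewrite ?mul0r// -exprSr.
transitivity (dotr z x * (W y w ^+ q * (W x w ^+ p +
    p%:R * (W x w ^+ p.-1 * (lin x a w ^+ 2 + lin x b w ^+ 2)))) +
  q%:R * dotr z y * (V x y w * (W x w ^+ p * W y w ^+ q.-1))); last first.
  by rewrite pE -natr1; ring.
by rewrite /V; field.
Qed.

Lemma expectation_abs2_xTu (x y : 'rV[R]_d) p q :
  \int[P]_w (abs2_xTu x a b w ^+ p * abs2_xTu y a b w ^+ q) =
  \sum_(i < p.+1) (p`! * q`! * 'C(p, i) * 'C(q, i))%:R *
    dotr x y ^+ (2 * i) * dotr x x ^+ (p - i) * dotr y y ^+ (q - i).
Proof.
have VE u : W u = V u u by apply/funext => w; rewrite /W /abs2_xTu !expr2.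
pose f p q := E (fun w => W x w ^+ p * W y w ^+ q).
pose h p q := E (fun w => V x y w * (W x w ^+ p * W y w ^+ q)).
apply: (@moment_recursion_solution _ _ _ _ f h).
- rewrite /f /E; under eq_Rintegral do rewrite !expr0 mulr1.
  by rewrite Rintegral_cst// /= (probability_setT P) mulr1.
(* The recursion at [p = 0] is [E_V] with [x] and [y] exchanged and exponent 0 on [W x]. *)
- move=> l; have := E_V y x y l 0; rewrite mul0r mul0r addr0.
  rewrite /f -VE => e.
  transitivity (E (fun w => W y w * (W y w ^+ l * W x w ^+ 0))).
    by apply: eq_Rintegral => w _; rewrite !expr0 exprS; ring.
  by rewrite e; congr (_ * _); apply: eq_Rintegral => w _; rewrite mulrC.
- move=> k l; rewrite -E_V /f -VE; apply: eq_Rintegral => w _.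
  by rewrite exprS; ring.
- move=> k l; have := E_V x y y k l; rewrite [dotr y x]dotrC => <-.
  by apply: eq_Rintegral => w _; rewrite /V; ring.
Qed.

Lemma expectation_k2s (x y : 'rV[R]_d) n :
  \int[P]_w (abs2_xTu x a b w ^+ n * abs2_xTu y a b w ^+ n) = k2s_formula n x y.
Proof.
rewrite expectation_abs2_xTu; apply: eq_bigr => i _.
have dotr_ge0 (z : 'rV[R]_d) : 0 <= dotr z z.
  by apply: sumr_ge0 => j _; rewrite -expr2 sqr_ge0.
rewrite [(norm2 x * _) ^+ _]exprM (exprMn 2 (norm2 x)) /norm2 !sqr_sqrtr// exprMn.
rewrite !natrM; ring.
Qed.

Lemma integrable_abs2_xTu (x y : 'rV[R]_d) p q :
  P.-integrable setT (EFin \o (fun w => abs2_xTu x a b w ^+ p * abs2_xTu y a b w ^+ q)).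
Proof. exact: (gpoly_integrable s0 hab (gpoly_WW x y p q)). Qed.

End moments.

(** * A law of large numbers from fourth moments *)

Lemma cvg_of_summable_pow4 {R : realType} (u : R^nat) :
  (\sum_(n <oo) (u n ^+ 4)%:E)%E \is a fin_num -> u @ \oo --> 0.
Proof.
move=> fin; have u0 n : 0 <= u n ^+ 4 by rewrite (exprM _ 2 2) sqr_ge0.
have /cvg_series_cvg_0 /cvgrPdist_lt u4 : cvgn (series (fun n => u n ^+ 4)).
  apply: nondecreasing_is_cvgn; first exact: nondecreasing_series.
  exists (fine (\sum_(n <oo) (u n ^+ 4)%:E)%E) => _ [n _ <-].
  rewrite -lee_fin fineK// /series/= -sumEFin.
  by apply: nneseries_lim_ge => k _ _; rewrite lee_fin.
apply/cvgrPdist_lt => e e0; have e4 : 0 < e ^+ 4 by exact: exprn_gt0.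
apply: filterS (u4 _ e4) => n /=.
by rewrite !sub0r !normrN normrX ltr_pXn2r// nnegrE ltW.
Qed.

(** The fourth moment of [S n / n] is at most [C / n^2], which is summable. Exchanging sum and
    integral, the series of fourth powers has finite expectation, hence is finite almost
    everywhere. *)
Lemma ae_cvg_mean {R : realType} {dT : measure_display} {T : measurableType dT}
    (P : probability T R) (S : nat -> T -> R) (C : R) :
  (forall n, measurable_fun setT (S n)) ->
  (forall n, (\int[P]_w (S n w ^+ 4)%:E <= (C * n%:R ^+ 2)%:E)%E) ->
  {ae P, forall w, (fun n => n%:R^-1 * S n w) @ \oo --> 0}.
Proof.
move=> mS S4; pose h n w := (n.+1%:R^-1 * S n.+1 w) ^+ 4.
have C0 : 0 <= C.
  have := S4 1%N; rewrite expr1n mulr1 => /(le_trans _); rewrite -lee_fin; apply.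
  by apply: integral_ge0 => w _; rewrite lee_fin (exprM _ 2 2) sqr_ge0.
have h0 n w : (0 <= (h n w)%:E)%E by rewrite lee_fin /h (exprM _ 2 2) sqr_ge0.
have mh n : measurable_fun setT (h n).
  by apply: measurable_funX; exact: measurable_funM.
have mhE n : measurable_fun setT (fun w => (h n w)%:E) by exact/measurable_EFinP.
have ih n : (\int[P]_w (h n w)%:E <= (C / n.+1%:R ^+ 2)%:E)%E.
  under eq_integral do rewrite /h exprMn EFinM.
  rewrite ge0_integralZl//=; last 2 first.
  - by apply/measurable_EFinP; exact: measurable_funX.
  - by move=> w _; rewrite lee_fin (exprM _ 2 2) sqr_ge0.
  apply: le_trans (lee_wpmul2l _ (S4 n.+1)) _; first by rewrite lee_fin exprn_ge0.
  rewrite -EFinM lee_fin le_eqVlt; apply/orP; left; apply/eqP.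
  have : n.+1%:R != 0 :> R by rewrite pnatr_eq0.
  by move: n.+1%:R => x x0; field.
have sumh N : (\sum_(0 <= n < N) \int[P]_w (h n w)%:E <= (2 * C)%:E)%E.
  (* The bound [2 - 1 / N] on the sum of the first [N] inverse squares is strong enough for
     induction. *)
  suff {N} : forall N, (\sum_(0 <= n < N.+1) \int[P]_w (h n w)%:E <=
      (C * (2 - N.+1%:R^-1))%:E)%E.
    move=> H; case: N => [|N]; first by rewrite big_geq// lee_fin mulr_ge0.
    apply: le_trans (H N) _; rewrite lee_fin mulrC ler_wpM2r//.
    by rewrite lerBlDr lerDl.
  elim=> [|N IH].
    rewrite big_nat1; apply: le_trans (ih 0%N) _; rewrite lee_fin ler_wpM2l//.
    by rewrite expr1n invr1 lerBrDr.
  rewrite big_nat_recr//=; apply: le_trans (leeD IH (ih _)) _.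
  rewrite -EFinD lee_fin -mulrDr ler_wpM2l//.
  have n0 : 0 < N.+1%:R :> R by [].
  rewrite -[N.+2%:R]natr1; set x := N.+1%:R in n0 *.
  rewrite -subr_ge0 (_ : _ - _ = (x * (x + 1) ^+ 2)^-1); last first.
    by field; rewrite !gt_eqF// addr_gt0.
  by rewrite invr_ge0 mulr_ge0 ?sqr_ge0// ltW.
have ih_sum : P.-integrable setT (fun w => \sum_(n <oo) (h n w)%:E)%E.
  apply/integrableP; split.
    apply: ge0_emeasurable_sum => //.
  under eq_integral do rewrite gee0_abs ?nneseries_ge0//.
  rewrite integral_nneseries//; apply: le_lt_trans (ltry (2 * C)).
  apply: lime_le; last by apply: nearW => N; exact: sumh.
  by apply: is_cvg_nneseries => n _ _; exact: integral_ge0.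
have := integrable_ae measurableT ih_sum.
apply: filterS => w /(_ I) /cvg_of_summable_pow4 cv.
by rewrite -(cvg_shiftS (fun n => n%:R^-1 * S n w)).
Qed.

Section random_features.
Context {R : realType} {dT : measure_display} {T : measurableType dT}.
Variables (P : probability T R) (d : nat) (Ua Ub : nat * 'I_d -> T -> R).
Hypothesis hU : iid_CN P Ua Ub.
Variables (n : nat) (x y : 'rV[R]_d).

Let s0 : Num.sqrt 2^-1 != 0 :> R.
Proof. by rewrite gt_eqF// sqrtr_gt0 invr_gt0. Qed.

(** The injection [f] of column indices into row [r] turns an event on the row into an event of the
    whole family. *)
Lemma iid_CN_row r : iid_CN P (fun j => Ua (r, j)) (fun j => Ub (r, j)).
Proof.
case: hU => mU indU; split=> [|J A uJ mA].
  by case=> j; [exact: (mU (inl (r, j)))|exact: (mU (inr (r, j)))].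
pose f (i : 'I_d + 'I_d) : (nat * 'I_d) + (nat * 'I_d) :=
  match i with inl j => inl (r, j) | inr j => inr (r, j) end.
pose A' (i : (nat * 'I_d) + (nat * 'I_d)) : set R :=
  match i with inl j => A (inl j.2) | inr j => A (inr j.2) end.
have fI : injective f by move=> [i|i] [j|j] //= [->].
rewrite (_ : \bigcap_(i in _) _ =
    \bigcap_(i in [set i | i \in map f J]) (reim_family Ua Ub i @^-1` A' i)).
  rewrite indU ?map_inj_uniq// ?big_map; first by apply: eq_bigr => -[j|j] _.
  by case=> j; exact: mA.
apply/seteqP; split=> w /= h.
  by move=> _ /mapP[[j|j] jJ ->]; exact: (h _ jJ).
by move=> [j|j] jJ; exact: (h _ (map_f f jJ)).
Qed.

Local Notation g := (reim_family Ua Ub).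

Let gpoly_mono (J J' : {pred (nat * 'I_d) + (nat * 'I_d)}) F :
  {subset J <= J'} -> gpoly g J F -> gpoly g J' F.
Proof.
move=> JJ' [p pJ Fp]; exists p => //; apply: sub_all pJ => c.
by apply: sub_all => i /JJ'.
Qed.

Let row (i : (nat * 'I_d) + (nat * 'I_d)) : nat :=
  match i with inl q => q.1 | inr q => q.1 end.

Let W r w := abs2_xTu x (fun j => Ua (r, j)) (fun j => Ub (r, j)) w ^+ n *
  abs2_xTu y (fun j => Ua (r, j)) (fun j => Ub (r, j)) w ^+ n.

Let gpoly_W r : gpoly g [pred i | row i == r] (W r).
Proof.
apply: gpolyM; apply: gpolyX; apply: gpoly_abs2_xTu => j;
  by [apply: (@gpoly_var _ _ _ _ g _ (inl (r, j))); rewrite inE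
     |apply: (@gpoly_var _ _ _ _ g _ (inr (r, j))); rewrite inE].
Qed.

Let m k := k2s_formula (n * k) x y.
Let K := k2s_formula n x y.
Let E F := \int[P]_w F w.

Let E_WX r k : E (fun w => W r w ^+ k) = m k.
Proof.
rewrite /m -(expectation_k2s (iid_CN_row r)).
by apply: eq_Rintegral => w _; rewrite /W exprMn -!exprM.
Qed.

Let ED J F G : gpoly g J F -> gpoly g J G -> E (fun w => F w + G w) = E F + E G.
Proof.
move=> hF hG.
by rewrite /E (RintegralD _ (gpoly_integrable s0 hU hF) (gpoly_integrable s0 hU hG)).
Qed.

Let EZ J c F : gpoly g J F -> E (fun w => c * F w) = c * E F.
Proof. by move=> hF; rewrite /E (RintegralZl _ _ (gpoly_integrable s0 hU hF)). Qed.

Let E_sum k (F : 'I_k -> T -> R) : (forall i, gpoly g predT (F i)) ->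
  E (fun w => \sum_i F i w) = \sum_i E (F i).
Proof.
move=> hF.
exact: (proj2 (Rintegral_sum (index_enum _) (fun i => gpoly_integrable s0 hU (hF i)))).
Qed.

Let E1 : E (fun=> 1) = 1.
Proof. by rewrite /E Rintegral_cst//= (probability_setT P) mulr1. Qed.

Let Y r w := W r w - K.

Let gpoly_Y r : gpoly g [pred i | row i == r] (Y r).
Proof. by apply: gpolyD (gpoly_W r) (gpoly_cst _ _ _). Qed.

(** Equality of moments across rows takes the place of identical distribution; it follows from the
    binomial expansion of [W r - K]. *)
Let E_YX k : exists c, forall r, E (fun w => Y r w ^+ k) = c.
Proof.
exists (\sum_(i < k.+1) ((- K) ^+ i *+ 'C(k, i)) * m (k - i)) => r.
have hF (i : 'I_k.+1) : gpoly g predT (fun w => W r w ^+ (k - i)).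
  by apply: gpoly_mono (gpolyX _ (gpoly_W r)).
transitivity (\sum_(i < k.+1) E (fun w => ((- K) ^+ i *+ 'C(k, i)) * W r w ^+ (k - i))).
  rewrite -E_sum; last by move=> i; exact: (gpolyM (gpoly_cst _ _ _) (hF i)).
  apply: eq_Rintegral => w _; rewrite /Y exprDn; apply: eq_bigr => i _.
  by rewrite mulrnAl mulrC.
by apply: eq_bigr => i _; rewrite (EZ _ (hF i)) E_WX.
Qed.

Let S N w := \sum_(r < N) Y r w.

Let gpoly_S N : gpoly g [pred i | (row i < N)%N] (S N).
Proof.
apply: gpoly_sum => r; apply: gpoly_mono (gpoly_Y r) => i.
by rewrite !inE => /eqP ->.
Qed.

(** [S N] involves only rows below [N], whereas [Y N] involves row [N]. *)
Let E_SY N i k : E (fun w => S N w ^+ i * Y N w ^+ k) =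
  E (fun w => S N w ^+ i) * E (fun w => Y N w ^+ k).
Proof.
apply: (gpoly_indep s0 hU _ (gpolyX i (gpoly_S N)) (gpolyX k (gpoly_Y N))).
by move=> j; rewrite !inE => + /eqP jN; rewrite jN ltnn.
Qed.

Let E_Y r : E (Y r) = 0.
Proof.
rewrite /Y (ED (gpoly_W r) (gpoly_cst _ _ _)).
have -> : E (W r) = K.
  transitivity (m 1); last by rewrite /m muln1.
  by rewrite -(E_WX r 1); apply: eq_Rintegral => w _; rewrite expr1.
by rewrite /E Rintegral_cst//= (probability_setT P) mulr1 subrr.
Qed.

Let gpoly_SY N i k : gpoly g predT (fun w => S N w ^+ i * Y N w ^+ k).
Proof.
by apply: gpolyM; apply: gpolyX; [apply: gpoly_mono (gpoly_S N)|apply: gpoly_mono (gpoly_Y N)].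
Qed.

Let gpoly_ZSY (c : R) N i k : gpoly g predT (fun w => c * (S N w ^+ i * Y N w ^+ k)).
Proof. exact: (gpolyM (gpoly_cst _ _ _) (gpoly_SY N i k)). Qed.

Let SS N w : S N.+1 w = S N w + Y N w.
Proof. by rewrite /S big_ord_recr. Qed.

Let E_X0 (F : T -> R) : E (fun w => F w ^+ 0) = 1.
Proof. by rewrite -[RHS]E1; apply: eq_Rintegral => w _; rewrite expr0. Qed.

Let E_S N : E (fun w => S N w ^+ 1) = 0.
Proof.
under [LHS]eq_Rintegral do rewrite expr1.
transitivity (\sum_(r < N) E (Y r)); last by rewrite big1.
by apply: (E_sum (F := fun r : 'I_N => Y r)) => r; apply: gpoly_mono (gpoly_Y r).
Qed.

Let E_SXS N k : E (fun w => S N.+1 w ^+ k) =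
  \sum_(i < k.+1) 'C(k, i)%:R * (E (fun w => S N w ^+ (k - i)) * E (fun w => Y N w ^+ i)).
Proof.
transitivity (E (fun w => \sum_(i < k.+1) 'C(k, i)%:R * (S N w ^+ (k - i) * Y N w ^+ i))).
  apply: eq_Rintegral => w _; rewrite SS exprDn.
  by apply: eq_bigr => i _; rewrite mulr_natl.
rewrite E_sum => [|i]; last exact: gpoly_ZSY.
by apply: eq_bigr => i _; rewrite (EZ _ (gpoly_SY _ _ _)) E_SY.
Qed.

Let E_Y1 r : E (fun w => Y r w ^+ 1) = 0.
Proof. by rewrite -[RHS](E_Y r); apply: eq_Rintegral => w _; rewrite expr1. Qed.

Let fourth_moment_le : exists C, forall N, E (fun w => S N w ^+ 4) <= C * N%:R ^+ 2.
Proof.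
have [c2 Y2] := E_YX 2; have [c4 Y4] := E_YX 4.
have S0 k : E (fun w => S 0 w ^+ k.+1) = 0.
  rewrite /E; under eq_Rintegral do rewrite /S big_ord0 expr0n.
  by rewrite Rintegral_cst// mul0r.
have S2 N : E (fun w => S N w ^+ 2) = N%:R * c2.
  elim: N => [|N IH]; first by rewrite S0 mul0r.
  rewrite E_SXS !big_ord_recr big_ord0 /= IH Y2 !E_X0 E_Y1 bin0 bin1 binn -natr1; ring.
(* Only [Y r ^+ 4] and products of two distinct squares survive centring; each of the
   [N (N - 1) / 2] pairs of rows occurs 6 times. *)
have S4 N : E (fun w => S N w ^+ 4) = 3 * (N%:R * (N%:R - 1)) * c2 ^+ 2 + N%:R * c4.
  elim: N => [|N IH]; first by rewrite S0; ring.
  have b2 : 'C(4, 2) = 6%N by []; have b3 : 'C(4, 3) = 4%N by [].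
  rewrite E_SXS !big_ord_recr big_ord0 /= IH E_S S2 Y2 Y4 !E_X0 E_Y1.
  rewrite bin0 bin1 b2 b3 binn -natr1; ring.
have c40 : 0 <= c4.
  by rewrite -(Y4 0%N); apply: Rintegral_ge0 => w _; rewrite (exprM _ 2 2) sqr_ge0.
exists (3 * c2 ^+ 2 + c4) => N; rewrite S4.
have N0 : 0 <= N%:R :> R by [].
have NN : N%:R <= N%:R ^+ 2 :> R by rewrite -natrX ler_nat; case: (N) => // k; rewrite leq_pmulr.
have := mulr_ge0 N0 (sqr_ge0 c2); have := ler_wpM2r c40 NN; nra.
Qed.

Lemma ae_cvg_feature_inner :
  {ae P, forall w, (fun D => feature_inner n D x y Ua Ub w) @ \oo --> K}.
Proof.
have [C S4] := fourth_moment_le.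
have iS N k := gpoly_integrable s0 hU (gpolyX k (gpoly_S N)).
have mS N : measurable_fun setT (S N).
  have := measurable_int _ (iS N 1%N); rewrite (_ : EFin \o _ = EFin \o S N).
    by move/measurable_EFinP.
  by apply/funext => w /=; rewrite expr1.
have S4e N : (\int[P]_w (S N w ^+ 4)%:E <= (C * N%:R ^+ 2)%:E)%E.
  rewrite -[leLHS]fineK ?lee_fin; first exact: S4.
  exact: (integrable_fin_num measurableT (iS N 4%N)).
apply: filterS (ae_cvg_mean mS S4e) => w.
(* The shift excludes [D = 0], where the inverse is 0 and averaging the constant [K] would not
   return [K]. *)
rewrite -cvg_shiftS -(cvg_shiftS (fun D => feature_inner n D x y Ua Ub w)) /= => cv.
rewrite (_ : (fun D => feature_inner _ _ _ _ _ _ _) = (fun D => D.+1%:R^-1 * S D.+1 w + K)).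
  have := cvgD cv (cvg_cst K); rewrite add0r; exact.
apply/funext => D; rewrite /feature_inner /S /Y sumrB sumr_const card_ord mulrBr.
by rewrite -[K *+ _]mulr_natl mulKf ?pnatr_eq0// subrK.
Qed.

End random_features.

Theorem theorem2 (R : realType) (dT : measure_display) (T : measurableType dT)
    (P : probability T R) (d s : nat) :
  (0 < d)%N ->
  (* expectation formula *)
  (forall (a b : 'I_d -> T -> R), iid_CN P a b ->
     forall x y : 'rV[R]_d,
       ('E_P[fun w => (abs2_xTu x a b w ^+ s * abs2_xTu y a b w ^+ s)%R]
        = (k2s_formula s x y)%:E)%E) /\
  (* random-feature approximation: almost sure convergence as D -> oo *)
  (forall (Ua Ub : nat * 'I_d -> T -> R), iid_CN P Ua Ub ->
     forall x y : 'rV[R]_d,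
       {ae P, forall w, (fun D : nat => feature_inner s D x y Ua Ub w) @ \oo
                          --> k2s_formula s x y}).
Proof.
move=> _; split=> [a b hab x y|Ua Ub hU x y]; last exact: ae_cvg_feature_inner.
rewrite unlock -(expectation_k2s hab) /Rintegral fineK//.
exact: (integrable_fin_num measurableT (integrable_abs2_xTu hab x y s s)).
Qed.
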